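(* Every full group relation algebra is isomorphic to a direct product of full group relation algebras on simple group frames.
   Context: A group pair consists of the following data. - Pairwise disjoint groups $G_x$ ($x\in I$), with identity $e_x$. - An equivalence relation $\mathcal E$ on $I$. - For each $(x,y)\in\mathcal E$, an isomorphism $\varphi_{xy}:G_x/H_{xy}\to G_y/K_{xy}$, where $H_{xy}\trianglelefteq G_x$ and $K_{xy}\trianglelefteq G_y$. Notation: $\circ$ is the complex product; $\varphi_{xy}[S]$ is the union of images of the $H_{xy}$-cosets contained in $S$; the map induced by $\varphi_{xy}$ modulo a normal subgroup $N\supseteq H_{xy}$ sends each coset $C$ of $N$ to $\varphi_{xy}[C]$. A group frame is a group pair such that for all $(x,y),(y,z)\in\mathcal E$: - $\varphi_{xx}$ is the identity automorphism of $G_x/\{e_x\}$; - $\varphi_{yx}=\varphi_{xy}^{-1}$; - $\varphi_{xy}[H_{xy}\circ H_{xz}]=K_{xy}\circ H_{yz}$; - applying first the map induced by $\varphi_{xy}$ on $G_x/(H_{xy}\circ H_{xz})$ and then the map induced by $\varphi_{yz}$ on $G_y/(K_{xy}\circ H_{yz})$ equals the map induced by $\varphi_{xz}$ on $G_x/(H_{xy}\circ H_{xz})$. With cosets $H_{xy,\gamma}$ ($\gamma<\kappa_{xy}$, $H_{xy,0}=H_{xy}$) enumerated without repetitions and $K_{xy,\gamma}=\varphi_{xy}(H_{xy,\gamma})$, let $R_{xy,\alpha}=\bigcup_\gamma H_{xy,\gamma}\times(K_{xy,\gamma}\circ K_{xy,\alpha})$. The full group relation algebra on a group frame $\mathcal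 F$ has as universe all unions of subfamilies of the $R_{xy,\alpha}$, with base set $U=\bigcup_x G_x$ and unit $E=\bigcup_{(x,y)\in\mathcal E}G_x\times G_y$. Its operations are union, complement relative to $E$, relational composition, converse, and the constant $\mathrm{id}_U$. A group frame is simple if $I\neq\emptyset$ and $\mathcal E=I\times I$. *)

(* Defs.v *)
From HB Require Import structures.
From mathcomp Require Import all_boot.
From mathcomp Require Import boolp classical_sets functions.

Set Implicit Arguments.
Unset Strict Implicit.
Unset Printing Implicit Defensive.

Local Open Scope classical_set_scope.
Local Open Scope group_scope.

(* The library has quotients of finite groups only. Here G is arbitrary: the   *)
(* elements of G / H are the cosets of H, as sets, and its product is the      *)
(* complex product of sets.                                                    *)

Definition complex_prod (G : groupType) (A B : set G) : set G :=
  [set a * b | a in A & b in B].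

Notation "A ∘ B" := (complex_prod A B) (at level 40, left associativity).

Definition normal_subgroup (G : groupType) (H : set G) : Prop :=
  group_closed (mem H) /\ (forall g h : G, H h -> H (h ^ g)).

Definition lcos (G : groupType) (H : set G) (g : G) : set G :=
  [set g * h | h in H].

Definition cosets (G : groupType) (H : set G) : set (set G) := range (lcos H).

(* [f] restricts to an isomorphism G / H -> G' / K. Its values outside of      *)
(* [cosets H] are irrelevant.                                                  *)
Definition quotient_iso (G G' : groupType) (H : set G) (K : set G')
    (f : set G -> set G') : Prop :=
  set_bij (cosets H) (cosets K) f /\
  {in cosets H &, forall A B, f (A ∘ B) = f A ∘ f B}.

(* The groups form a family of types, so their disjoint union is the dependent *)
(* sum [base] below. The data H, K, phi are total in x and y, but only their   *)
(* values at related x, y are constrained or used.                             *)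

Unset Implicit Arguments.

Record group_pair : Type := GroupPair {
  gp_I : Type;
  gp_G : gp_I -> groupType;
  gp_E : gp_I -> gp_I -> Prop;
  gp_refl : forall x, gp_E x x;
  gp_sym : forall x y, gp_E x y -> gp_E y x;
  gp_trans : forall x y z, gp_E x y -> gp_E y z -> gp_E x z;
  gp_H : forall x y : gp_I, set (gp_G x);
  gp_K : forall x y : gp_I, set (gp_G y);
  gp_phi : forall x y : gp_I, set (gp_G x) -> set (gp_G y);
  gp_normalH : forall x y, gp_E x y -> normal_subgroup (gp_H x y);
  gp_normalK : forall x y, gp_E x y -> normal_subgroup (gp_K x y);
  gp_iso : forall x y, gp_E x y ->
    quotient_iso (gp_H x y) (gp_K x y) (gp_phi x y)
}.

Set Implicit Arguments.

Arguments gp_G {_} x.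
Arguments gp_E {_} x y.
Arguments gp_refl {_} x.
Arguments gp_sym {_ x y}.
Arguments gp_trans {_ x y z}.
Arguments gp_H {_} x y.
Arguments gp_K {_} x y.
Arguments gp_phi {_} x y.
Arguments gp_normalH {_ x y}.
Arguments gp_normalK {_ x y}.
Arguments gp_iso {_ x y}.

Definition phi_img (P : group_pair) (x y : gp_I P) (S : set (gp_G x)) :
    set (gp_G y) :=
  \bigcup_(C in [set C | cosets (gp_H x y) C /\ C `<=` S]) gp_phi x y C.

Arguments phi_img {P} x y S.

(* The map induced by phi_xy modulo N sends a coset C of N to [phi_img x y C]. *)
Record is_frame (P : group_pair) : Prop := IsFrame {
  frame_id : forall x : gp_I P,
    [/\ gp_H x x = [set 1], gp_K x x = [set 1] &
        {in cosets (gp_H x x), forall C, gp_phi x x C = C}];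
  frame_inv : forall x y : gp_I P, gp_E x y ->
    [/\ gp_H y x = gp_K x y, gp_K y x = gp_H x y,
        {in cosets (gp_H x y), forall C, gp_phi y x (gp_phi x y C) = C} &
        {in cosets (gp_K x y), forall C, gp_phi x y (gp_phi y x C) = C}];
  frame_img : forall x y z : gp_I P, gp_E x y -> gp_E y z ->
    phi_img x y (gp_H x y ∘ gp_H x z) = gp_K x y ∘ gp_H y z;
  frame_comp : forall x y z : gp_I P, gp_E x y -> gp_E y z ->
    {in cosets (gp_H x y ∘ gp_H x z),
      forall C, phi_img y z (phi_img x y C) = phi_img x z C}
}.

Record group_frame : Type := GroupFrame {
  gf_pair :> group_pair;
  gf_frame : is_frame gf_pair
}.

Definition simple_frame (F : group_frame) : Prop :=
  inhabited (gp_I F) /\ forall x y : gp_I F, gp_E x y.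

(* Algebras of the similarity type of relation algebras, without axioms: those *)
(* play no role in isomorphisms and direct products.                           *)

Record ra_alg : Type := RaAlg {
  ra_car :> Type;
  ra_join : ra_car -> ra_car -> ra_car;
  ra_compl : ra_car -> ra_car;
  ra_comp : ra_car -> ra_car -> ra_car;
  ra_conv : ra_car -> ra_car;
  ra_id : ra_car
}.

Definition ra_isomorphic (A B : ra_alg) : Prop :=
  exists f : A -> B, bijective f /\
    [/\ forall r s, f (ra_join r s) = ra_join (f r) (f s),
        forall r, f (ra_compl r) = ra_compl (f r),
        forall r s, f (ra_comp r s) = ra_comp (f r) (f s),
        forall r, f (ra_conv r) = ra_conv (f r) &
        f (ra_id A) = ra_id B].

Definition ra_prod (J : Type) (A : J -> ra_alg) : ra_alg :=
  {| ra_car := forall j, A j;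
     ra_join := fun r s j => ra_join (r j) (s j);
     ra_compl := fun r j => ra_compl (r j);
     ra_comp := fun r s j => ra_comp (r j) (s j);
     ra_conv := fun r j => ra_conv (r j);
     ra_id := fun j => ra_id (A j) |}.

Definition base (P : group_pair) : Type := {x : gp_I P & gp_G x}.

Definition base_inj (P : group_pair) (x : gp_I P) (g : gp_G x) : base P :=
  existT (fun x => gp_G x : Type) x g.

Arguments base_inj {P x} g.

(* The cosets of H_xy are enumerated by themselves: A is the coset             *)
(* H_xy,alpha and C runs through the H_xy,gamma.                               *)
Definition Rxy (P : group_pair) (x y : gp_I P) (A : set (gp_G x)) :
    set (base P * base P) :=
  \bigcup_(C in cosets (gp_H x y))
    ((base_inj @` C) `*` (base_inj @` (gp_phi x y C ∘ gp_phi x y A))).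

Arguments Rxy {P} x y A.

Definition gen_rels (P : group_pair) : set (set (base P * base P)) :=
  [set R | exists (x y : gp_I P) (A : set (gp_G x)),
    [/\ gp_E x y, cosets (gp_H x y) A & R = Rxy x y A]].

Arguments gen_rels : clear implicits.

Definition gra_universe (P : group_pair) : set (set (base P * base P)) :=
  [set R | exists2 S, S `<=` gen_rels P & R = \bigcup_(Q in S) Q].

Arguments gra_universe : clear implicits.

Definition gra_unit (P : group_pair) : set (base P * base P) :=
  [set p | gp_E (projT1 p.1) (projT1 p.2)].

Arguments gra_unit : clear implicits.

Definition rel_comp (U : Type) (R S : set (U * U)) : set (U * U) :=
  [set p | exists2 u, R (p.1, u) & S (u, p.2)].

Definition rel_conv (U : Type) (R : set (U * U)) : set (U * U) :=
  [set p | R (p.2, p.1)].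

Definition rel_id (U : Type) : set (U * U) := [set p | p.1 = p.2].

Arguments rel_id : clear implicits.

Section Quotients.
Variables (G : groupType) (H : set G).
Hypothesis nH : normal_subgroup H.

Let H1 : H 1.
Proof. by case: nH => -[/set_mem]. Qed.

Let Hdiv a b : H a -> H b -> H (a / b).
Proof.
by case: nH => -[_ hd] _ Ha Hb; apply: set_mem; apply: hd; apply: mem_set.
Qed.

Let Hinv a : H a -> H a^-1.
Proof. by move=> Ha; rewrite -[a^-1]mul1g; exact: Hdiv. Qed.

Let Hmul a b : H a -> H b -> H (a * b).
Proof. by move=> Ha Hb; rewrite -[b]invgK; apply: Hdiv => //; exact: Hinv. Qed.

Let Hconj g h : H h -> H (h ^ g).
Proof. by case: nH => _; exact. Qed.

Lemma normal_subgroup1 : H 1. Proof. exact: H1. Qed.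

Lemma normal_subgroupM a b : H a -> H b -> H (a * b). Proof. exact: Hmul. Qed.

Lemma normal_subgroupV a : H a -> H a^-1. Proof. exact: Hinv. Qed.

Lemma lcosP g a : lcos H g a <-> H (g^-1 * a).
Proof.
split=> [[h Hh <-]|Ha]; first by rewrite mulKg.
by exists (g^-1 * a) => //; rewrite mulVKg.
Qed.

Lemma lcos_refl g : lcos H g g.
Proof. by apply/lcosP; rewrite mulVg. Qed.

Lemma lcos_eq g a : lcos H g a -> lcos H a = lcos H g.
Proof.
move=> /lcosP Ha; apply/seteqP; split=> b /lcosP Hb; apply/lcosP.
  by have := Hmul Ha Hb; rewrite -mulgA mulVKg.
by have := Hmul (Hinv Ha) Hb; rewrite invgM invgK -mulgA mulVKg.
Qed.

Lemma lcos_cosets g : cosets H (lcos H g).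
Proof. by exists g. Qed.

Lemma cosets_lcos C g : cosets H C -> C g -> C = lcos H g.
Proof. by case=> a _ <- /lcos_eq ->. Qed.

Lemma lcosM a b : lcos H a ∘ lcos H b = lcos H (a * b).
Proof.
apply/seteqP; split=> [c [a' [h Hh <-]] [b' [k Hk <-]] <-|c [h Hh <-]].
  exists (h ^ b * k); first by apply: Hmul => //; exact: Hconj.
  by rewrite conjgE !mulgA mulgK.
by exists a; [exact: lcos_refl|exists (b * h); [exists h|rewrite mulgA]].
Qed.

End Quotients.

(* On a group frame the universe is closed under the operations.               *)

Section Frame.
Variable F : group_frame.
Local Notation G := (@gp_G F).
Local Notation E := (@gp_E F).
Local Notation H := (@gp_H F).
Local Notation K := (@gp_K F).

(* The element b of G_y lies in the image under phi_xy of the coset of a.      *)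
Definition phirel (x y : gp_I F) (a : G x) (b : G y) : Prop :=
  gp_phi x y (lcos (H x y) a) b.

Section OneMap.
Variables (x y : gp_I F).
Hypothesis exy : E x y.
Implicit Types (a h d : G x) (b k : G y).

Let nH := gp_normalH exy.
Let nK := gp_normalK exy.

Lemma phi_cosets (C : set (G x)) : cosets (H x y) C -> cosets (K x y) (gp_phi x y C).
Proof. by case: (gp_iso exy) => -[hf _ _] _; exact: hf. Qed.

Lemma phirelE a b :
  phirel a b -> gp_phi x y (lcos (H x y) a) = lcos (K x y) b.
Proof.
by apply: cosets_lcos => //; apply: phi_cosets; exact: lcos_cosets.
Qed.

Lemma phi_mul (a a' : G x) :
  gp_phi x y (lcos (H x y) a) ∘ gp_phi x y (lcos (H x y) a') =
  gp_phi x y (lcos (H x y) (a * a')).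
Proof.
case: (gp_iso exy) => _ hm; rewrite -hm ?lcosM//;
  by apply/mem_set; exact: lcos_cosets.
Qed.

Lemma phirelM a b a' b' :
  phirel a b -> phirel a' b' -> phirel (a * a') (b * b').
Proof. by move=> ab ab'; rewrite /phirel -phi_mul; exists b => //; exists b'. Qed.

Lemma phirel_ex a : exists b : G y, phirel a b.
Proof.
have [b _ eb] := phi_cosets (lcos_cosets (H x y) a).
by exists b; rewrite /phirel -eb; exact: lcos_refl.
Qed.

Lemma phirel_exr b : exists a : G x, phirel a b.
Proof.
case: (gp_iso exy) => -[_ _ hs] _.
have [_ [a _ <-] eb] := hs _ (lcos_cosets (K x y) b).
by exists a; rewrite /phirel eb; exact: lcos_refl.
Qed.

Lemma phirelHE a h (b : G y) : H x y h -> phirel (a * h) b <-> phirel a b.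
Proof.
by move=> Hh; rewrite /phirel (@lcos_eq _ _ nH a)//; exists h.
Qed.

Lemma phirelK a b k : phirel a b -> K x y k -> phirel a (b * k).
Proof. by move=> ab Kk; rewrite /phirel (phirelE ab); exists k. Qed.

Lemma phirel_diff a b b' : phirel a b -> phirel a b' -> K x y (b^-1 * b').
Proof.
by move=> ab; rewrite {1}/phirel (phirelE ab) => /lcosP.
Qed.

Lemma phirel1 : phirel (1 : G x) (1 : G y).
Proof.
have [b b1] := phirel_ex 1; have b2 := phirelM b1 b1; rewrite mulg1 in b2.
have := phirel_diff b1 b2; rewrite mulKg => Kb.
rewrite -(mulgV b); apply: phirelK => //; exact: normal_subgroupV.
Qed.

Lemma phirelV a (b : G y) : phirel a b -> phirel a^-1 b^-1.
Proof.
move=> ab; have [c ac] := phirel_ex a^-1.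
have cb := phirelM ac ab; rewrite mulVg in cb.
have := phirel_diff phirel1 cb; rewrite invg1 mul1g => Kcb.
have Kcb' : K x y (b * c) .
  have -> : b * c = (c * b) ^ c by rewrite conjgE !mulgA mulVg mul1g.
  by case: nK => _; exact.
have := phirelK ac (normal_subgroupV nK Kcb').
by rewrite invgM mulVKg.
Qed.

(* R_xy,alpha for the coset of d relates a to b iff phi_xy sends the coset of  *)
(* a d to the coset of b.                                                      *)
Lemma RxyP d (p : base F * base F) : Rxy x y (lcos (H x y) d) p <->
  exists a b, p = (base_inj a, base_inj b) /\ phirel (a * d : G x) (b : G y).
Proof.
split.
  case: p => u v [_ [c _ <-]] [/= [a ca <-] [b cb <-]]; exists a, b; split=> //.
  by rewrite /phirel -phi_mul (lcos_eq nH ca).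
move=> [a [b [-> ab]]]; exists (lcos (H x y) a); first exact: lcos_cosets.
split=> /=; first by exists a => //; exact: lcos_refl.
by exists b => //; rewrite phi_mul.
Qed.

End OneMap.

Lemma phirel_sym x y a b : E x y -> @phirel x y a b -> @phirel y x b a.
Proof.
move=> exy ab; have [hH hK hl _] := frame_inv (gf_frame F) exy.
rewrite /phirel hH -(phirelE exy ab) hl; last exact/mem_set/lcos_cosets.
exact/lcos_refl/gp_normalH.
Qed.

Lemma phirel_refl x a b : @phirel x x a b <-> a = b.
Proof.
have [hH _ hl] := frame_id (gf_frame F) x.
rewrite /phirel hl; last exact/mem_set/lcos_cosets.
rewrite hH; split=> [[h -> <-]|->]; first by rewrite mulg1.
by exists 1 => //; rewrite mulg1.
Qed.

Section TwoMaps.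
Variables (x y z : gp_I F).
Hypotheses (exy : E x y) (eyz : E y z).
Implicit Types (u a h : G x) (v : G y) (w : G z).

Let exz : E x z := gp_trans exy eyz.
Let nxy := gp_normalH exy.
Let nxz := gp_normalH exz.
Let nyz := gp_normalH eyz.
Let Kxy := gp_normalK exy.

Let N := H x y ∘ H x z.

Let lcosN u a : lcos N u a <->
  exists h k, [/\ H x y h, H x z k & a = u * h * k].
Proof.
split; first by case=> _ [h Hh [k Hk <-]] <-; exists h, k; rewrite mulgA.
move=> [h [k [Hh Hk ->]]]; exists (h * k); last by rewrite mulgA.
by exists h => //; exists k.
Qed.

Let lcosN_H u a : lcos N u a -> lcos (H x y) a `<=` lcos N u.
Proof.
move=> /lcosN[h [k [Hh Hk ->]]] _ [h' Hh' <-]; apply/lcosN.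
exists (h * h' ^ k^-1), k; split=> //.
  by apply: normal_subgroupM => //; case: nxy => _; exact.
by rewrite conjgE invgK -!mulgA mulVg mulg1.
Qed.

Let lcosN_Hz u a : lcos N u a -> lcos (H x z) a `<=` lcos N u.
Proof.
move=> /lcosN[h [k [Hh Hk ->]]] _ [k' Hk' <-]; apply/lcosN.
by exists h, (k * k'); split; rewrite ?mulgA//; exact: normal_subgroupM.
Qed.

Let N1 : lcos N 1 = N.
Proof.
apply/seteqP; split=> [_ [a Na <-]|a Na]; first by rewrite mul1g.
by exists a; rewrite ?mul1g.
Qed.

Let imgP u (v : G y) :
  phi_img x y (lcos N u) v <-> exists2 a, lcos N u a & phirel a v.
Proof.
split=> [[_ [[a _ <-] aN] av]|[a Na av]].
  by exists a => //; apply/aN; exact: lcos_refl.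
exists (lcos (H x y) a) => //; split; first exact: lcos_cosets.
exact: lcosN_H.
Qed.

Let imgzP u (w : G z) :
  phi_img x z (lcos N u) w <-> exists2 h, H x y h & phirel (u * h) w.
Proof.
split=> [[_ [[a _ <-] aN] aw]|[h Hh hw]].
  have /lcosN[h [k [Hh Hk e]]] := aN _ (lcos_refl nxz a).
  by exists h => //; rewrite -(phirelHE exz _ _ Hk) -e.
exists (lcos (H x z) (u * h)) => //; split; first exact: lcos_cosets.
by apply: lcosN_Hz; apply/lcosN; exists h, 1; rewrite mulg1; split=> //;
  exact: normal_subgroup1.
Qed.

Let imgN : phi_img x y N = K x y ∘ H y z.
Proof. exact: (frame_img (gf_frame F)). Qed.

Let imgK u (v : G y) (k : G y) : H y z k ->
  phi_img x y (lcos N u) v -> phi_img x y (lcos N u) (v * k).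
Proof.
move=> Hk /imgP[a Na av].
have : phi_img x y (lcos N 1) k.
  rewrite N1 imgN; exists 1; first exact: normal_subgroup1.
  by exists k => //; rewrite mul1g.
case/imgP=> n Nn nk; apply/imgP; exists (a * n); last exact: phirelM.
move: Na Nn => /lcosN[h [l [Hh Hl ->]]] /lcosN[h' [l' [Hh' Hl' ->]]].
apply/lcosN; exists (h * h' ^ l^-1), (l * l'); split.
- by apply: normal_subgroupM => //; case: nxy => _; exact.
- exact: normal_subgroupM.
- by rewrite conjgE invgK !mulgA mulgVK mulg1.
Qed.

Let img2P u (w : G z) : phi_img y z (phi_img x y (lcos N u)) w <->
  exists v : G y, phirel u v /\ phirel v w.
Proof.
split=> [[_ [[v _ <-] vN] vw]|[v [uv vw]]].
  have /imgP[_ /lcosN[h [k [Hh Hk ->]]] nv] := vN _ (lcos_refl nyz v).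
  have : exists2 l : G y, H y z l & phirel k l.
    have [l kl] := phirel_ex exy k.
    have : phi_img x y (lcos N 1) l.
      apply/imgP; exists k => //; apply/lcosN; exists 1, k.
      by rewrite !mul1g; split=> //; exact: normal_subgroup1.
    rewrite N1 imgN => -[m Km [l' Hl' ml]]; exists l' => //.
    have -> : l' = l * (m^-1) ^ l'.
      by rewrite conjgE -ml !mulgA mulgK mulgV mul1g.
    apply: phirelK => //; case: Kxy => _; apply.
    exact: normal_subgroupV.
  move=> [l Hl kl]; exists (v * l^-1); split.
    rewrite -(phirelHE exy _ _ Hh) -[u * h](mulgK k).
    by apply: phirelM => //; exact: phirelV.
  by rewrite phirelHE//; exact: normal_subgroupV.
exists (lcos (H y z) v) => //; split; first exact: lcos_cosets.
move=> _ [k Hk <-]; apply: imgK => //; apply/imgP; exists u => //.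
by apply/lcosN; exists 1, 1; rewrite !mulg1; split=> //;
  exact: normal_subgroup1.
Qed.

Lemma phirel_comp u (w : G z) : (exists v : G y, phirel u v /\ phirel v w) <->
  (exists2 h, H x y h & phirel (u * h) w).
Proof.
rewrite -img2P -imgzP (frame_comp (gf_frame F))//.
exact/mem_set/lcos_cosets.
Qed.

End TwoMaps.

Lemma base_injK x : injective (@base_inj F x).
Proof.
move=> a b e; have := projT2_eq e.
by rewrite (Prop_irrelevance (projT1_eq e) erefl).
Qed.

Lemma Rxy_fst x y x' y' A (a : G x) (b : G y) :
  Rxy x' y' A (base_inj a, base_inj b) -> x' = x /\ y' = y.
Proof.
move=> [C _ [/= [a' _ ea] [b' _ eb]]].
by split; [exact: (projT1_eq ea)|exact: (projT1_eq eb)].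
Qed.

Lemma RxyE x y d (a : G x) (b : G y) : E x y ->
  Rxy x y (lcos (H x y) d) (base_inj a, base_inj b) <-> phirel (a * d) b.
Proof.
move=> exy; split=> [/(RxyP exy)[a' [b' [[]]]]|ab].
  by move=> /base_injK<- /base_injK<-.
by apply/(RxyP exy); exists a, b.
Qed.

Lemma universeP (X : set (base F * base F)) : gra_universe F X <->
  (forall x y (a : G x) (b : G y), X (base_inj a, base_inj b) ->
    E x y /\ exists d, phirel (a * d) b /\
      (forall (a' : G x) (b' : G y),
        phirel (a' * d) b' -> X (base_inj a', base_inj b'))).
Proof.
split=> [[S SR ->] x y a b [R SRR Rab]|hX].
  have [x' [y' [_ [exy [d _ <-] eR]]]] := SR _ SRR.
  move: Rab exy d eR; rewrite /= => Rab exy d eR; rewrite eR in Rab.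
  have [e1 e2] := Rxy_fst Rab; subst x' y'.
  split=> //; exists d; split=> [|a' b' ab']; first exact/RxyE.
  by exists R => //; rewrite eR; apply/RxyE.
exists [set R | gen_rels F R /\ R `<=` X]; first by move=> R [].
apply/seteqP; split=> [[[x a] [y b]] Xab|p [R [_ +] Rp]]; last exact.
have [exy [d [ad hd]]] := hX x y a b Xab.
exists (Rxy x y (lcos (H x y) d)); last exact/(RxyE d a b exy).
split.
  by exists x, y, (lcos (H x y) d); split=> //; exact: lcos_cosets.
by move=> _ /(RxyP exy)[a' [b' [-> /hd]]].
Qed.

Lemma universe_union (X Y : set (base F * base F)) :
  gra_universe F X -> gra_universe F Y -> gra_universe F (X `|` Y).
Proof.
move=> /universeP hX /universeP hY; apply/universeP => x y a b [/hX|/hY];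
  move=> [exy [d [ad hd]]]; split=> //; exists d; split=> // a' b' /hd;
  by [left|right].
Qed.

Lemma universe_compl (X : set (base F * base F)) :
  gra_universe F X -> gra_universe F (gra_unit F `\` X).
Proof.
move=> /universeP hX; apply/universeP => x y a b [/= exy nX]; split=> //.
have [a0 ab] := phirel_exr exy b.
exists (a^-1 * a0); split=> [|a' b' ab']; first by rewrite mulVKg.
split=> // /hX[_ [d [ad hd]]]; apply: nX; apply: hd.
have := phirelM exy (phirelV exy ab') ad.
rewrite !invgM mulVg invgK => h1.
have := phirelM exy ab h1.
by rewrite mulg1 !mulgA mulgV mul1g mulgVK.
Qed.

Lemma universe_comp (X Y : set (base F * base F)) :
  gra_universe F X -> gra_universe F Y -> gra_universe F (rel_comp X Y).
Proof.
move=> /universeP hX /universeP hY; apply/universeP => x z a c [[y b]/= Xab Ybc].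
have [exy [d [ad hd]]] := hX x y a b Xab.
have [eyz [e [be he]]] := hY y z b c Ybc.
split; first exact: gp_trans eyz.
have [e' ee'] := phirel_exr exy e.
have ade := phirelM exy ad ee'.
have [h Hh hc] : exists2 h, H x y h & phirel (a * d * e' * h) c.
  by apply/(phirel_comp exy eyz); exists (b * e).
exists (d * e' * h); split=> [|a' c']; first by rewrite !mulgA.
move=> ac'; have [v [uv vc]] : exists v : G y, phirel (a' * d * e') v /\
    phirel v c'.
  by apply/(phirel_comp exy eyz); exists h => //; rewrite -!mulgA mulgA in ac' *.
exists (base_inj (v * e^-1)); [apply: hd|apply: he; rewrite mulgVK//].
by rewrite -[a' * d](mulgK e'); apply: (phirelM exy) => //; exact: phirelV.
Qed.

Lemma universe_conv (X : set (base F * base F)) :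
  gra_universe F X -> gra_universe F (rel_conv X).
Proof.
move=> /universeP hX; apply/universeP => y x b a /hX[/= exy [d [ad hd]]].
split; first exact: gp_sym.
have [e de] := phirel_ex exy d^-1.
have eyx := gp_sym exy.
exists e; split=> [|b' a' ba'].
  by have := phirelM exy ad de; rewrite mulgK => /(phirel_sym exy).
apply: hd; have := phirelM exy (phirel_sym eyx ba') (phirelV exy de).
by rewrite invgK mulgK.
Qed.

Lemma universe_id : gra_universe F (rel_id (base F)).
Proof.
apply/universeP => x y a b e; have exy : x = y := projT1_eq e.
subst y; split; first exact: gp_refl.
exists 1; split=> [|a' b']; rewrite mulg1.
  by apply/phirel_refl; exact: base_injK e.
by move=> /phirel_refl->.
Qed.

End Frame.

Definition full_gra (F : group_frame) : ra_alg :=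
  {| ra_car := {X | gra_universe F X};
     ra_join := fun r s =>
       exist _ (sval r `|` sval s) (universe_union (svalP r) (svalP s));
     ra_compl := fun r =>
       exist _ (gra_unit F `\` sval r) (universe_compl (svalP r));
     ra_comp := fun r s =>
       exist _ (rel_comp (sval r) (sval s)) (universe_comp (svalP r) (svalP s));
     ra_conv := fun r => exist _ (rel_conv (sval r)) (universe_conv (svalP r));
     ra_id := exist _ (rel_id (base F)) (universe_id F) |}.

(* Main.v *)
(** A relation of the algebra relates only points whose indices are
    E-equivalent, so it is the disjoint union of its restrictions to the
    E-classes. On each class the frame restricts to a simple frame, and since
    relational composition passes only through points of the same class, cutting
    a relation into its restrictions is an isomorphism onto the product of the
    algebras of these simple frames. *)

Require Import Defs.
From mathcomp Require Import all_boot.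
From mathcomp Require Import boolp classical_sets.

Set Implicit Arguments.
Unset Strict Implicit.
Unset Printing Implicit Defensive.

Local Open Scope classical_set_scope.
Local Open Scope group_scope.

Section Restriction.
Variables (F : group_frame) (A : set (gp_I F)).

Definition restr_pair : group_pair :=
  @GroupPair {x | A x} (fun x => gp_G (sval x))
    (fun x y => gp_E (sval x) (sval y))
    (fun x => gp_refl (sval x))
    (fun x y => @gp_sym F (sval x) (sval y))
    (fun x y z => @gp_trans F (sval x) (sval y) (sval z))
    (fun x y => gp_H (sval x) (sval y))
    (fun x y => gp_K (sval x) (sval y))
    (fun x y => gp_phi (sval x) (sval y))
    (fun x y => @gp_normalH F (sval x) (sval y))
    (fun x y => @gp_normalK F (sval x) (sval y))
    (fun x y => @gp_iso F (sval x) (sval y)).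

(** Each frame condition is universal in the indices and mentions only data at those indices, so it
    passes to any subset of them. *)
Lemma restr_is_frame : is_frame restr_pair.
Proof.
split.
- by move=> x; exact: (frame_id (gf_frame F) (sval x)).
- by move=> x y; exact: (@frame_inv _ (gf_frame F) (sval x) (sval y)).
- move=> x y z.
  exact: (@frame_img _ (gf_frame F) (sval x) (sval y) (sval z)).
- move=> x y z.
  exact: (@frame_comp _ (gf_frame F) (sval x) (sval y) (sval z)).
Qed.

Definition restr : group_frame := GroupFrame restr_is_frame.

Definition emb (u : base restr) : base F :=
  @base_inj F (sval (projT1 u)) (projT2 u).

Lemma emb_inj : injective emb.
Proof.
case=> [[x Ax] a] [[y Ay] b] e; have exy : x = y := projT1_eq e.
subst y; have eab : a = b := base_injK e.
by rewrite (Prop_irrelevance Ay Ax) eab.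
Qed.

Lemma emb_ex (p : base F) : A (projT1 p) -> exists u, emb u = p.
Proof.
case: p => x a Ax.
by exists (@base_inj restr (exist _ x Ax) a).
Qed.

Lemma emb_idx u : A (projT1 (emb u)).
Proof. exact: svalP (projT1 u). Qed.

Definition restr_rel (X : set (base F * base F)) :
    set (base restr * base restr) :=
  [set p | X (emb p.1, emb p.2)].

(** The criterion [universeP] looks at one pair of indices at a time, and restriction keeps the
    groups and maps there, so the same shift [d] serves. *)
Lemma restr_universe X :
  gra_universe F X -> gra_universe restr (restr_rel X).
Proof.
move=> /universeP hX; apply/universeP => x y a b.
move=> /(hX (sval x) (sval y) a b)[exy [d [ad hd]]].
by split=> //; exists d; split=> // a' b'; exact: hd.
Qed.

End Restriction.

Lemma universe_unit (F : group_frame) (X : set (base F * base F)) p q :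
  gra_universe F X -> X (p, q) -> gp_E (projT1 p) (projT1 q).
Proof.
by case: p q => [x a] [y b] /universeP hX /(hX x y a b)[].
Qed.

Lemma full_gra_inj (F : group_frame) (r s : full_gra F) :
  sval r = sval s -> r = s.
Proof.
case: r s => [X hX] [Y hY] /= e; subst Y.
by rewrite (Prop_irrelevance hX hY).
Qed.

Section Decomposition.
Variable F : group_frame.

(** Classes are taken as sets, so that each gives exactly one factor and no representatives are
    chosen. *)
Definition eclass : Type :=
  {A : set (gp_I F) | exists x, A = [set y | gp_E x y]}.

Implicit Types (j : eclass).

Definition eclass_of (x : gp_I F) : eclass :=
  exist _ [set y | gp_E x y] (ex_intro _ x erefl).

Lemma eclass_E j x y : sval j x -> sval j y -> gp_E x y.
Proof.
by case: j => B [z eB] /=; rewrite eB => zx zy; exact: gp_trans (gp_sym zx) zy.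
Qed.

Lemma eclass_closed j x y : sval j x -> gp_E x y -> sval j y.
Proof. by case: j => B [z eB] /=; rewrite eB; exact: gp_trans. Qed.

Lemma eclass_eq j k x : sval j x -> sval k x -> j = k.
Proof.
move=> jx kx; have e : sval j = sval k.
  apply/seteqP; split=> y h.
    exact: (eclass_closed kx (eclass_E jx h)).
  exact: (eclass_closed jx (eclass_E kx h)).
case: j k e {jx kx} => [B hB] [C hC] /= e; subst C.
by rewrite (Prop_irrelevance hB hC).
Qed.

Definition component j : group_frame := restr (sval j).

Lemma component_simple j : simple_frame (component j).
Proof.
split; last by move=> [x jx] [y jy]; exact: (eclass_E jx jy).
by case: j => B [x eB]; split; exists x; rewrite /= eB; exact: gp_refl.
Qed.

Definition glue (Y : forall j, set (base (component j) * base (component j))) :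
    set (base F * base F) :=
  [set p | exists j u v, p = (emb u, emb v) /\ Y j (u, v)].

(** Distinct classes are disjoint and [emb] is injective, so a pair in the image of component [j]
    can come from no other component and from no other pair. *)
Lemma glueE Y j (u v : base (component j)) :
  glue Y (emb u, emb v) <-> Y j (u, v).
Proof.
split=> [[k [u' [v' [e Yuv]]]]|Yuv]; last by exists j, u, v.
have eu : emb u = emb u' := congr1 fst e.
have ev : emb v = emb v' := congr1 snd e.
(* Only once [k] and [j] are identified do [u'] and [u] have the same type, as [emb_inj]
   requires. *)
have ekj : k = j.
  apply: (@eclass_eq _ _ (projT1 (emb u))); last exact: emb_idx.
  by rewrite eu; exact: emb_idx.
by subst k; rewrite (emb_inj eu) (emb_inj ev).
Qed.

(** The block that [universeP] asks for lies over two indices of a single class, so the shift found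
    in that component works in [F]. *)
Lemma glue_universe Y :
  (forall j, gra_universe (component j) (Y j)) -> gra_universe F (glue Y).
Proof.
move=> hY; apply/universeP => x y a b [j [[[x' jx] a'] [[[y' jy] b'] [e Yab]]]].
have eu : @base_inj F x a = @base_inj F x' a' := congr1 fst e.
have ev : @base_inj F y b = @base_inj F y' b' := congr1 snd e.
have ex : x = x' := projT1_eq eu; have ey : y = y' := projT1_eq ev; subst x' y'.
have ea := base_injK eu; have eb := base_injK ev; subst a' b'.
have /universeP/(_ _ _ _ _ Yab)[exy [d [ad hd]]] := hY j.
split=> //; exists d; split=> // c c' /hd Ycc'.
exact: ((glueE Y (@base_inj (component j) (exist _ x jx) c)
  (@base_inj (component j) (exist _ y jy) c')).2 Ycc').
Qed.

Definition split_gra (r : full_gra F) :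
    ra_prod (fun j => full_gra (component j)) :=
  fun j => exist _ (restr_rel (A := sval j) (sval r))
    (restr_universe (sval j) (svalP r)).

Definition glue_gra (s : ra_prod (fun j => full_gra (component j))) :
    full_gra F :=
  exist _ (glue (fun j => sval (s j))) (glue_universe (fun j => svalP (s j))).

Lemma split_graK : cancel split_gra glue_gra.
Proof.
move=> r; apply: full_gra_inj; apply/seteqP; split=> [p|[p q] rpq].
  by move=> [j [u [v [-> ]]]].
(* Related points are E-equivalent, so the class of [p] contains both indices and its component
   accounts for the pair. *)
have epq := universe_unit (svalP r) rpq.
have [u eu] := @emb_ex F (sval (eclass_of (projT1 p))) p (gp_refl _).
have [v ev] := @emb_ex F (sval (eclass_of (projT1 p))) q epq.
by exists (eclass_of (projT1 p)), u, v; split; [|change (sval r (emb u, emb v))];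
  rewrite eu ev.
Qed.

Lemma glue_graK : cancel glue_gra split_gra.
Proof.
move=> s; apply: functional_extensionality_dep => j; apply: full_gra_inj.
by apply/seteqP; split=> -[u v]; have [] := glueE (fun k => sval (s k)) u v.
Qed.

Lemma split_gra_comp r s :
  split_gra (ra_comp r s) = ra_comp (split_gra r) (split_gra s).
Proof.
apply: functional_extensionality_dep => j; apply: full_gra_inj.
apply/seteqP; split=> -[u v] [w ruw swv]; last by exists (emb w).
(* The intermediate point [w] is E-equivalent to [emb u], hence stays in class [j] and has a
   preimage there. *)
have euw := universe_unit (svalP r) ruw.
have [w' ew] := emb_ex (eclass_closed (emb_idx u) euw).
by exists w'; rewrite /= /restr_rel /= ew.
Qed.

(** [emb] keeps indices, so the unit of [F] restricts to the unit of each component by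
    computation. *)
Lemma split_gra_compl r : split_gra (ra_compl r) = ra_compl (split_gra r).
Proof.
apply: functional_extensionality_dep => j; apply: full_gra_inj.
by apply/seteqP; split=> -[u v] [].
Qed.

Lemma split_gra_id : split_gra (ra_id (full_gra F)) = ra_id _.
Proof.
apply: functional_extensionality_dep => j; apply: full_gra_inj.
apply/seteqP; split=> -[u v]; first exact: emb_inj.
by rewrite /= /rel_id /restr_rel /= => ->.
Qed.

End Decomposition.

Theorem theorem6p2 (F : group_frame) :
  exists (J : Type) (Fs : J -> group_frame),
    (forall j : J, simple_frame (Fs j)) /\
    ra_isomorphic (full_gra F) (ra_prod (fun j : J => full_gra (Fs j))).
Proof.
exists (eclass F), (@component F); split; first exact: component_simple.
exists (@split_gra F); split.
  by exists (@glue_gra F); [exact: split_graK|exact: glue_graK].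
split; [|exact: split_gra_compl|exact: split_gra_comp| |exact: split_gra_id].
(* Pulling back along [emb] commutes with union and converse by computation. *)
- move=> r s; apply: functional_extensionality_dep => j.
  exact: full_gra_inj.
- move=> r; apply: functional_extensionality_dep => j.
  exact: full_gra_inj.
Qed.
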